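(* Let $A\in\mathbb{R}^{m\times n}$, $b\in\mathbb{R}^m$, $c\in\mathbb{R}^n$ be LP data satisfying the Assumption in the context, and let $\mu_p$ be the LP sharpness of the primal LP $\min\{c^\top x:Ax=b,\ x\ge0\}$. Then $$\mu_p=\inf_{\Delta c\in\mathbb{R}^n}\left\{\frac{\|P_{\vec V_p}(\Delta c)\|}{\|P_{\vec V_p}(c)\|}\ :\ \operatorname{OPT}(c+\Delta c,\mathcal{F}_p)\neq\emptyset\ \text{ and }\ \operatorname{OPT}(c+\Delta c,\mathcal{F}_p)\not\subset\operatorname{OPT}(c,\mathcal{F}_p)\right\}.$$
   Context: Norms are Euclidean, $\operatorname{Dist}$ is Euclidean distance to a set, and $P_{\mathcal{C}}$ is Euclidean projection onto $\mathcal{C}$. $V_p:=\{x\in\mathbb{R}^n:Ax=b\}$, $\vec V_p:=\operatorname{Null}(A)$, $\mathcal{F}_p:=V_p\cap\mathbb{R}^n_+$; for $g\in\mathbb{R}^n$, $\operatorname{OPT}(g,\mathcal{F}_p):=\arg\min_{x\in\mathcal{F}_p}g^\top x$ (empty if no minimizer exists); $\mathcal{X}^\star:=\operatorname{OPT}(c,\mathcal{F}_p)$. The dual LP is $\max b^\top y$ s.t. $A^\top y+s=c,\ s\ge0$. Assumption: the primal has an optimal solution, and both the primal and the dual have feasible solutions that are not optimal (for the dual, in the slack variable $s$). LP sharpness: $\mu_p:=\inf_{x\in\mathcal{F}_p\setminus\mathcal{X}^\star}\dfrac{\operatorname{Dist}(x,V_p\cap H_p^\star)}{\operatorname{Dist}(x,\mathcal{X}^\star)}$,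 where $H_p^\star:=\{\hat x\in\mathbb{R}^n:c^\top\hat x=c^\top x^\star\}$ for any $x^\star\in\mathcal{X}^\star$. *)

(* Defs.v *)
From HB Require Import structures.
From mathcomp Require Import all_boot all_order all_algebra.
From mathcomp Require Import all_classical all_reals ereal.

Set Implicit Arguments.
Unset Strict Implicit.
Unset Printing Implicit Defensive.

Import Order.TTheory GRing.Theory Num.Theory.
Local Open Scope classical_set_scope.
Local Open Scope ring_scope.

Section Euclidean.
Context {R : realType} {n : nat}.
Implicit Types (u v x : 'cV[R]_n) (C : set 'cV[R]_n).

Definition dot u v : R := (u^T *m v) 0 0.

(* The norm that MathComp-Analysis puts on matrices is the sup norm. *)
Definition euclid_norm u : R := Num.sqrt (dot u u).

(* A real infimum: meaningful for nonempty C only, as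
   [euclid_dist x set0 = 0]. *)
Definition euclid_dist x C : R := inf [set euclid_norm (x - z) | z in C].

(* The nearest point of C to x; it exists and is unique when C is nonempty,
   closed and convex.  If there is none, [euclid_proj C x = 0]. *)
Definition euclid_proj C x : 'cV[R]_n :=
  xget 0 [set p | C p /\
    forall z, C z -> euclid_norm (x - p) <= euclid_norm (x - z)].

Definition nonneg_orthant : set 'cV[R]_n := [set x | forall i, 0 <= x i 0].

Definition OPT (g : 'cV[R]_n) (F : set 'cV[R]_n) : set 'cV[R]_n :=
  [set x | F x /\ forall z, F z -> dot g x <= dot g z].

End Euclidean.

Section LP.
Context {R : realType} {m n : nat}.
Variables (A : 'M[R]_(m, n)) (b : 'cV[R]_m) (c : 'cV[R]_n).

Definition Vp : set 'cV[R]_n := [set x | A *m x = b].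

Definition null_space : set 'cV[R]_n := [set x | A *m x = 0].

Definition Fp : set 'cV[R]_n := Vp `&` nonneg_orthant.

Definition Xstar : set 'cV[R]_n := OPT c Fp.

Definition dual_feasible : set ('cV[R]_m * 'cV[R]_n) :=
  [set ys | A^T *m ys.1 + ys.2 = c /\ nonneg_orthant ys.2].

Definition dual_optimal : set ('cV[R]_m * 'cV[R]_n) :=
  [set ys | dual_feasible ys /\
    forall zt, dual_feasible zt -> dot b zt.1 <= dot b ys.1].

Definition dual_feasible_slack : set 'cV[R]_n :=
  [set s | exists y, dual_feasible (y, s)].

Definition dual_optimal_slack : set 'cV[R]_n :=
  [set s | exists y, dual_optimal (y, s)].

Definition lp_assumption : Prop :=
  [/\ Xstar !=set0,
      Fp `\` Xstar !=set0 &
      dual_feasible_slack `\` dual_optimal_slack !=set0].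

(* All points of [Xstar] have the same objective value, so this is
   {x | c^T x = c^T x*} for every x* in [Xstar]. *)
Definition Hpstar : set 'cV[R]_n :=
  [set x | exists2 xs, Xstar xs & dot c x = dot c xs].

Definition lp_sharpness : \bar R :=
  ereal_inf [set (euclid_dist x (Vp `&` Hpstar) / euclid_dist x Xstar)%:E
            | x in Fp `\` Xstar].

End LP.

(* Main.v *)
Require Import Defs.
From mathcomp Require Import all_boot all_order all_algebra.
From mathcomp Require Import all_classical all_reals ereal.
From mathcomp Require Import zify ring lra.

(** Write [q] for the projection of [c] on the null space of [A] and, for a
    feasible non-optimal [x], let [p] be the point of the optimal set [Xstar]
    nearest to [x] and [u = x - p].  On the affine space [A x = b] the objective
    has gradient [q], so the sharpness ratio at [x] is
    [(c . u / |u|) / |q|] ([euclid_dist_level]), and the theorem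
    compares [c . u / |u|] with the size of the perturbations of [c].

    If [x] is optimal for [c + dc], then [(c + dc) . u <= 0], so
    [c . u <= - dc . u <= |P dc| |u|] with [P] the projection on the null space
    ([perturbation_cost]).  Every admissible perturbation is thus at least as
    large as some sharpness ratio.

    Conversely ([efficient_perturbation]) take [dc = - (c . u / |u|^2) u], the
    smallest perturbation that makes [x] and [p] equally good.  Suppose first
    that the perturbed program is bounded.  If all its optimal points were in
    [Xstar], then, as [u] makes an obtuse angle with [Xstar] at [p], [p] and so
    [x] would be optimal for it too, which is absurd.  If the perturbed program
    is unbounded, scale [dc] down to the last multiple [s dc] for which it is
    bounded ([critical_scaling]).  There some recession direction [d] has
    [(c + s dc) . d = 0] and [dc . d < 0].  Moving along [d] preserves
    optimality for [c + s dc]; it leaves [Xstar] if [c . d > 0], and if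
    [c . d = 0] then [d] is a recession direction of [Xstar] with [u . d > 0],
    which contradicts the choice of [p].

    Three minima have to be attained: bounded linear programs, the nearest
    point of a polyhedron, and the critical scaling, which is itself the
    optimal value of a linear program over the recession cone.  All of them
    come from one descent on supports ([min_by_support]): as long as a point is
    not dominated by a minimizer over the points with no larger support, one can
    move to a point that is no worse and has smaller support, and there are
    only finitely many supports. *)

Set Implicit Arguments.
Unset Strict Implicit.
Unset Printing Implicit Defensive.

Import Order.TTheory GRing.Theory Num.Theory.
Local Open Scope classical_set_scope.
Local Open Scope ring_scope.

(** * The Euclidean inner product *)

Section Euclidean.
Context {R : realType} {n : nat}.
Implicit Types (u v w x z p d : 'cV[R]_n) (a : R).

Lemma dotE u v : dot u v = \sum_i u i 0 * v i 0.
Proof. by rewrite /dot mxE; apply: eq_bigr => i _; rewrite mxE. Qed.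

Lemma dotC u v : dot u v = dot v u.
Proof. by rewrite !dotE; apply: eq_bigr => i _; rewrite mulrC. Qed.

Lemma dot0l v : dot 0 v = 0.
Proof. by rewrite /dot trmx0 mul0mx mxE. Qed.

Lemma dotDr u v w : dot u (v + w) = dot u v + dot u w.
Proof. by rewrite /dot mulmxDr mxE. Qed.

Lemma dotZr a u v : dot u (a *: v) = a * dot u v.
Proof. by rewrite /dot -scalemxAr mxE. Qed.

Lemma dotNr u v : dot u (- v) = - dot u v.
Proof. by rewrite -scaleN1r dotZr mulN1r. Qed.

Lemma dotDl u v w : dot (u + v) w = dot u w + dot v w.
Proof. by rewrite !(dotC _ w) dotDr. Qed.

Lemma dotZl a u v : dot (a *: u) v = a * dot u v.
Proof. by rewrite !(dotC _ v) dotZr. Qed.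

Lemma dotNl u v : dot (- u) v = - dot u v.
Proof. by rewrite !(dotC _ v) dotNr. Qed.

Definition dot_linE := (dotDr, dotDl, dotNr, dotNl, dotZr, dotZl).

Lemma dot_sqrD u v : dot (u + v) (u + v) = dot u u + 2 * dot u v + dot v v.
Proof. by rewrite !dot_linE (dotC v u); ring. Qed.

Lemma dot_sqrB u v : dot (u - v) (u - v) = dot u u - 2 * dot u v + dot v v.
Proof. by rewrite dot_sqrD !dot_linE; ring. Qed.

Lemma dot_ge0 u : 0 <= dot u u.
Proof. by rewrite dotE; apply: sumr_ge0 => i _; rewrite -expr2 sqr_ge0. Qed.

Lemma dot_eq0 u : (dot u u == 0) = (u == 0).
Proof.
apply/eqP/eqP => [|->]; last by rewrite dot0l.
rewrite dotE => /eqP; rewrite psumr_eq0 => [/allP u0|i _]; last first.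
  by rewrite -expr2 sqr_ge0.
apply/colP => i; rewrite mxE; apply/eqP.
by have := u0 i (mem_index_enum i); rewrite /= mulf_eq0 orbb.
Qed.

Lemma dot_gt0 u : (0 < dot u u) = (u != 0).
Proof. by rewrite lt0r dot_ge0 andbT dot_eq0. Qed.

Lemma euclid_norm_ge0 u : 0 <= euclid_norm u.
Proof. exact: sqrtr_ge0. Qed.

Lemma euclid_norm_gt0 u : (0 < euclid_norm u) = (u != 0).
Proof. by rewrite sqrtr_gt0 dot_gt0. Qed.

Lemma sqr_euclid_norm u : euclid_norm u ^+ 2 = dot u u.
Proof. by rewrite sqr_sqrtr // dot_ge0. Qed.

Lemma ler_euclid_norm u v :
  (euclid_norm u <= euclid_norm v) = (dot u u <= dot v v).
Proof. by rewrite ler_sqrt // dot_ge0. Qed.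

Lemma euclid_normZ a u : euclid_norm (a *: u) = `|a| * euclid_norm u.
Proof.
by rewrite /euclid_norm dotZl dotZr mulrA -expr2 sqrtrM ?sqr_ge0 // sqrtr_sqr.
Qed.

(** Expand [0 <= |b u - a v|^2] for [a = |u|] and [b = |v|]. *)
Lemma cauchy_schwarz u v : dot u v <= euclid_norm u * euclid_norm v.
Proof.
set a := euclid_norm u; set b := euclid_norm v.
have [->|u0] := eqVneq u 0.
  by rewrite dot0l mulr_ge0 ?euclid_norm_ge0.
have [->|v0] := eqVneq v 0.
  by rewrite dotC dot0l mulr_ge0 ?euclid_norm_ge0.
have a0 : 0 < a by rewrite euclid_norm_gt0.
have b0 : 0 < b by rewrite euclid_norm_gt0.
have := dot_ge0 (b *: u - a *: v).
rewrite !dot_linE -!sqr_euclid_norm -/a -/b (dotC v u) => h.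
rewrite -(ler_pM2l (mulr_gt0 a0 b0)); nra.
Qed.

Lemma euclid_distE x p (C : set 'cV[R]_n) : C p ->
  (forall z, C z -> euclid_norm (x - p) <= euclid_norm (x - z)) ->
  euclid_dist x C = euclid_norm (x - p).
Proof.
move=> Cp pmin; apply/eqP; rewrite eq_le; apply/andP; split.
  apply: ge_inf; last by exists p.
  by exists 0 => _ [z _ <-]; exact: euclid_norm_ge0.
apply: lb_le_inf; first by exists (euclid_norm (x - p)), p.
by move=> _ [z Cz <-]; exact: pmin.
Qed.

(** The variational inequality of a nearest point: otherwise a short move from
    [p] towards [w] would come closer to [x]. *)
Lemma nearest_obtuse (C : set 'cV[R]_n) x p w :
  (forall z, C z -> euclid_norm (x - p) <= euclid_norm (x - z)) ->
  (forall t, 0 <= t <= 1 -> C (p + t *: (w - p))) ->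
  dot (x - p) (w - p) <= 0.
Proof.
move=> pmin seg; set a := dot _ _; set b := dot (w - p) (w - p).
have key t : 0 <= t <= 1 -> 2 * t * a <= t ^+ 2 * b.
  move=> /seg /pmin; rewrite ler_euclid_norm opprD addrA.
  by rewrite [leRHS]dot_sqrB !(dotZl, dotZr) -/a -/b; nra.
rewrite leNgt; apply/negP => a0.
(* [t = a / b] minimizes the quadratic of [key]; it is cut off at [t = 1]. *)
have [ba|ab] := leP b a; first by have := key 1; rewrite ler01 lexx; lra.
have b0 : 0 < b by lra.
have /key : 0 <= a / b <= 1.
  apply/andP; split; first by rewrite divr_ge0 // ltW.
  by rewrite ler_pdivrMr // mul1r ltW.
have -> : 2 * (a / b) * a = 2 * (a ^+ 2 / b) by ring.
have -> : (a / b) ^+ 2 * b = a ^+ 2 / b by field; lra.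
have : 0 < a ^+ 2 / b by rewrite divr_gt0 // exprn_gt0.
lra.
Qed.

End Euclidean.

(** * Orthogonal projection on a null space *)

Section NullSpaceProjection.
Context {R : realType} {m n : nat}.
Variable A : 'M[R]_(m, n).
Implicit Types (v z p : 'cV[R]_n).

Lemma dot_mulmx (y : 'cV[R]_m) z : dot (A^T *m y) z = dot y (A *m z).
Proof. by rewrite /dot trmx_mul trmxK mulmxA. Qed.

(** [A A^T y = 0] forces [A^T y = 0], so [A A^T] has the rank of [A] and the
    normal equations [A A^T y = A v] are solvable. *)
Lemma normal_equation v : exists y : 'cV[R]_m, A *m (A^T *m y) = A *m v.
Proof.
have sub : (A *m A^T <= A^T)%MS by exact: submxMl.
have rk : \rank A^T = \rank (A *m A^T).
  apply/eqP; rewrite eqn_leq (mxrankS sub) andbT.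
  have kk : (kermx (A *m A^T) <= kermx A)%MS.
    apply/sub_kermxP/row_matrixP => i; rewrite row_mul row0.
    set k := row i _.
    have : k *m (A *m A^T) = 0 by rewrite -row_mul mulmx_ker row0.
    move=> k0; have /eqP : dot (k *m A)^T (k *m A)^T = 0.
      by rewrite /dot trmxK trmx_mul mulmxA -(mulmxA k) k0 mul0mx mxE.
    by rewrite dot_eq0 => /eqP /(congr1 trmx); rewrite trmxK trmx0.
  have := mxrankS kk; rewrite !mxrank_ker mxrank_tr.
  have := rank_leq_row A; have := rank_leq_row (A *m A^T); lia.
have eqs : (A^T <= A *m A^T)%MS.
  by have := mxrank_leqif_sup sub => -[_ <-]; rewrite rk.
have /submxP[D hD] : (v^T *m A^T <= A *m A^T)%MS.
  exact: submx_trans (submxMl _ _) eqs.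
exists D^T; apply: trmx_inj; rewrite !trmx_mul !trmxK hD.
by rewrite mulmxA.
Qed.

(** The solution of the normal equations satisfies Pythagoras' identity, which
    makes it the only nearest point and so the value that [xget] returns. *)
Lemma euclid_proj_nullP v :
  A *m euclid_proj (null_space A) v = 0 /\
  forall z, A *m z = 0 -> dot (v - euclid_proj (null_space A) v) z = 0.
Proof.
have [y hy] := normal_equation v.
set p0 := v - A^T *m y.
have Ap0 : A *m p0 = 0 by rewrite mulmxBr hy subrr.
have orth z : A *m z = 0 -> dot (v - p0) z = 0.
  by move=> Az; rewrite opprB addrC subrK dot_mulmx Az /dot mulmx0 mxE.
have pyth z : A *m z = 0 ->
    dot (v - z) (v - z) = dot (v - p0) (v - p0) + dot (p0 - z) (p0 - z).
  move=> Az; have := orth (p0 - z); rewrite mulmxBr Ap0 Az subrr => /(_ erefl).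
  have -> : v - z = (v - p0) + (p0 - z) by rewrite addrA subrK.
  by move=> o; rewrite [LHS]dot_sqrD o mulr0 addr0.
suff -> : euclid_proj (null_space A) v = p0 by [].
rewrite /euclid_proj; case: xgetP => [p _ [Np pmin]|/(_ p0)[]]; last first.
  by split => // z Nz; rewrite ler_euclid_norm (pyth z Nz) lerDl dot_ge0.
have := pmin p0 Ap0; rewrite ler_euclid_norm (pyth p Np) gerDl => le0.
have /eqP : dot (p0 - p) (p0 - p) = 0 by apply/eqP; rewrite eq_le le0 dot_ge0.
by rewrite dot_eq0 subr_eq0 => /eqP.
Qed.

Lemma euclid_proj_null_fix v : A *m v = 0 -> euclid_proj (null_space A) v = v.
Proof.
move=> Av; have [Ap orth] := euclid_proj_nullP v.
apply/eqP; rewrite eq_sym -subr_eq0 -dot_eq0; apply/eqP/orth.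
by rewrite mulmxBr Av Ap subrr.
Qed.

Lemma dot_euclid_proj_null v z : A *m z = 0 ->
  dot (euclid_proj (null_space A) v) z = dot v z.
Proof.
move=> Az; have [_ /(_ z Az)] := euclid_proj_nullP v.
by rewrite dotDl dotNl => /eqP; rewrite subr_eq0 => /eqP.
Qed.

End NullSpaceProjection.

(** * Minimization by descent on supports *)

Section SupportDescent.
Context {R : realType} {n : nat}.
Implicit Types (f : 'cV[R]_n -> R) (F : set 'cV[R]_n) (z d p w : 'cV[R]_n).

Definition supp z : {set 'I_n} := [set i | z i 0 != 0]%SET.

Lemma supp_subP w z :
  reflect (forall i, z i 0 = 0 -> w i 0 = 0) (supp w \subset supp z).
Proof.
apply: (iffP fintype.subsetP) => h i; last first.
  by rewrite !inE; apply: contra_neq; exact: h.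
by move=> zi; have := h i; rewrite !inE zi eqxx; case: eqP => // _ /(_ erefl).
Qed.

(** Descent by decreasing support sends every point of [F] to a no worse point
    that minimizes [f] among the points of [F] supported in some [S].  Since
    there are finitely many [S], the best of these slice minimizers is a
    minimizer over [F].  This replaces compactness: it also applies to
    unbounded [F], as long as the descent is always possible. *)
Lemma min_by_support f F : F !=set0 ->
  (forall z, F z ->
    (exists p, [/\ F p, f p <= f z, supp p \subset supp z &
       forall w, F w -> supp w \subset supp z -> f p <= f w]) \/
    (exists z', [/\ F z', f z' <= f z & supp z' \proper supp z])) ->
  exists2 p, F p & forall w, F w -> f p <= f w.
Proof.
move=> [z0 Fz0] step.
pose good (S : {set 'I_n}) p := [/\ F p, supp p \subset S &
  forall w, F w -> supp w \subset S -> f p <= f w].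
have descent k z : F z -> (#|supp z| < k)%N ->
    exists S p, good S p /\ f p <= f z.
  elim: k z => // k IH z Fz; rewrite ltnS => zk.
  have [[p [Fp fp sp pmin]]|[z' [Fz' fz' sz']]] := step z Fz.
    by exists (supp z), p.
  have [] := IH z' Fz'; first exact: leq_trans (proper_card sz') zk.
  by move=> S [p [gp fp]]; exists S, p; split => //; apply: le_trans fp fz'.
(* The default [z0] keeps [best S] in [F] for slices without a minimizer. *)
pose best S := xget z0 [set p | good S p].
have Fbest S : F (best S).
  by rewrite /best; case: xgetP => [p _ []|].
have [S _ Smin] := @arg_minP _ _ {set 'I_n} finset.set0 predT
  (fun S => f (best S)) erefl.
exists (best S) => // w Fw.
have [S' [p [[Fp sp pmin] fp]]] := descent _ w Fw (ltnSn _).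
apply: le_trans fp; apply: le_trans (Smin S' erefl) _.
rewrite /best; case: xgetP => [q _ [_ _ qmin]|/(_ p)[]]; last by split.
exact: qmin.
Qed.

(** The ratio test of the simplex method: along a direction with a negative
    entry, the first entry of [z] to vanish stops the move and leaves the
    support.  The last clause says that the move stops before [z + d] if that
    point is infeasible. *)
Lemma ratio_test z d : (forall i, 0 <= z i 0) -> supp d \subset supp z ->
  (exists i, d i 0 < 0) ->
  exists t, [/\ 0 <= t, forall i, 0 <= (z + t *: d) i 0,
    supp (z + t *: d) \proper supp z &
    forall i, z i 0 + d i 0 < 0 -> t <= 1].
Proof.
move=> z0 /supp_subP sub [i0 di0].
have [i di imin] :=
  @arg_minP _ _ _ i0 (fun i => d i 0 < 0) (fun i => z i 0 / - d i 0) di0.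
set t := z i 0 / - d i 0 in imin.
have t0 : 0 <= t by rewrite divr_ge0 // oppr_ge0 ltW.
exists t; split => //.
- move=> j; rewrite !mxE; have [dj|dj] := ltP (d j 0) 0.
    by have := imin j dj; rewrite ler_pdivlMr ?oppr_gt0 //; lra.
  by rewrite addr_ge0 // mulr_ge0.
- apply/properP; split.
    by apply/supp_subP => j zj; rewrite !mxE zj (sub j zj) mulr0 addr0.
  exists i; rewrite !inE.
    by apply/eqP => zi; move: di; rewrite (sub i zi) ltxx.
  by rewrite negbK !mxE /t; apply/eqP; field; rewrite lt_eqF.
- move=> j zdj; have dj : d j 0 < 0 by have := z0 j; lra.
  apply: le_trans (imin j dj) _.
  by rewrite ler_pdivrMr ?oppr_gt0 // mul1r; lra.
Qed.

End SupportDescent.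

(** * Minima attained on standard-form polyhedra *)

Section StandardForm.
Context {R : realType} {m n : nat}.
Variables (M : 'M[R]_(m, n)) (h : 'cV[R]_m).
Implicit Types (x z d p w g : 'cV[R]_n).

(** Adding the equation [g . x = k] to a standard-form polyhedron gives another
    one, so optimal sets and normalized recession cones are again of this
    form. *)
Lemma Fp_level g (k : R) x :
  Fp (col_mx M g^T) (col_mx h k%:M) x <-> Fp M h x /\ dot g x = k.
Proof.
rewrite /Fp /Vp /= mul_col_mx; split.
  by move=> [/eq_col_mx[-> gx] x0]; rewrite /dot gx mxE eqxx.
move=> [[-> x0] gx]; split => //; congr col_mx.
by apply/matrixP => i j; rewrite !ord1 [RHS]mxE -gx.
Qed.

Lemma Fp_ray z d : Fp M h z -> M *m d = 0 -> nonneg_orthant d ->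
  Fp M h (z + d).
Proof.
move=> [Mz z0] Md d0; split; first by rewrite /Vp /= mulmxDr Mz Md addr0.
by move=> i; rewrite mxE addr_ge0.
Qed.

Lemma Fp_segment z w t : Fp M h z -> Fp M h w -> 0 <= t <= 1 ->
  Fp M h (z + t *: (w - z)).
Proof.
move=> [Mz z0] [Mw w0] /andP[t0 t1]; split.
  by rewrite /Vp /= mulmxDr -scalemxAr mulmxBr Mz Mw subrr scaler0 addr0.
by move=> i; rewrite !mxE; have := z0 i; have := w0 i; nra.
Qed.

Lemma ratio_test_Fp z d : Fp M h z -> M *m d = 0 -> supp d \subset supp z ->
  (exists i, d i 0 < 0) ->
  exists t, [/\ 0 <= t, Fp M h (z + t *: d), supp (z + t *: d) \proper supp z &
    forall i, z i 0 + d i 0 < 0 -> t <= 1].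
Proof.
move=> [Mz z0] Md sub neg; have [t [t0 tpos tsupp t1]] := ratio_test z0 sub neg.
exists t; split => //; split => //.
by rewrite /Vp /= mulmxDr -scalemxAr Mz Md scaler0 addr0.
Qed.

(** At [z], if [g] is constant on the slice of the points supported in the
    support of [z], then [z] is a slice minimizer.  Otherwise some direction in
    the slice decreases [g]; it has a negative entry since [g] is nonnegative on
    the recession cone, and the ratio test applies. *)
Lemma lp_attained g : Fp M h !=set0 ->
  (forall d, M *m d = 0 -> nonneg_orthant d -> 0 <= dot g d) ->
  OPT g (Fp M h) !=set0.
Proof.
move=> F0 rec; suff [p Fp0 pmin] : exists2 p, Fp M h p &
  forall w, Fp M h w -> dot g p <= dot g w by exists p.
apply: min_by_support => // z Fz.
have [[d [Md sd gd]]|flat] := pselect (exists d,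
    [/\ M *m d = 0, supp d \subset supp z & dot g d < 0]).
  right; have neg : exists i, d i 0 < 0.
    apply: contrapT => nneg; have : 0 <= dot g d.
      apply: rec => // i; rewrite leNgt; apply/negP => di.
      by apply: nneg; exists i.
    by rewrite leNgt gd.
  have [t [t0 Ft st _]] := ratio_test_Fp Fz Md sd neg.
  by exists (z + t *: d); split => //; rewrite !dot_linE; nra.
left; exists z; split => // w Fw /supp_subP sw.
rewrite leNgt; apply/negP => gw; apply: flat; exists (w - z); split.
- by case: Fz Fw => Mz _ [Mw _]; rewrite mulmxBr Mz Mw subrr.
- by apply/supp_subP => i zi; rewrite !mxE zi sw // subrr.
- by rewrite !dot_linE; lra.
Qed.

(** At [z], project [x] on the affine hull of the slice of [z].  If the
    projection is nonnegative, it is the slice minimizer.  Otherwise move from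
    [z] towards it until an entry vanishes: the distance to [x] decreases all
    along that segment. *)
Lemma nearest_attained x : Fp M h !=set0 ->
  exists2 p, Fp M h p &
    forall w, Fp M h w -> euclid_norm (x - p) <= euclid_norm (x - w).
Proof.
move=> F0; suff [p Fp0 pmin] : exists2 p, Fp M h p &
    forall w, Fp M h w -> dot (x - p) (x - p) <= dot (x - w) (x - w).
  by exists p => // w Fw; rewrite ler_euclid_norm pmin.
apply: (min_by_support (f := fun p => dot (x - p) (x - p))) => // z Fz.
(* The null space of [N] is the direction of the affine hull of the slice. *)
pose N := col_mx M (diag_mx (\row_i (i \notin supp z)%:R)).
have NP d : N *m d = 0 <-> M *m d = 0 /\ supp d \subset supp z.
  rewrite /N mul_col_mx -[X in _ = X]col_mx0; split.
    move=> /eq_col_mx[Md Dd]; split => //; apply/supp_subP => i zi.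
    have /colP/(_ i) := Dd; rewrite mul_diag_mx !mxE.
    by rewrite inE negbK zi eqxx mul1r.
  move=> [-> /supp_subP sd]; congr col_mx; apply/colP => i.
  rewrite mul_diag_mx !mxE inE negbK; case: eqP => [/sd ->|_].
    by rewrite mulr0.
  by rewrite mul0r.
have [Nq orth] := euclid_proj_nullP N (x - z).
set q := euclid_proj _ _ in Nq orth.
have /NP[Mq sq] := Nq.
have [zq0|/existsNP[i /negP]] := pselect (nonneg_orthant (z + q)).
  have zqF : Fp M h (z + q).
    by case: Fz => Mz _; split => //; rewrite /Vp /= mulmxDr Mz Mq addr0.
  have zqmin w : Fp M h w -> supp w \subset supp z ->
      dot (x - (z + q)) (x - (z + q)) <= dot (x - w) (x - w).
    move=> Fw /supp_subP sw.
    have Nd : N *m (w - (z + q)) = 0.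
      apply/NP; split.
        case: Fw zqF => Mw _ [Mzq _].
        by rewrite mulmxBr Mw; move: Mzq; rewrite /Vp /= => ->; rewrite subrr.
      apply/supp_subP => i zi; rewrite !mxE zi sw //.
      by rewrite (supp_subP _ _ sq i zi) addr0 subrr.
    have := orth _ Nd; rewrite -addrA -opprD => o.
    have -> : x - w = (x - (z + q)) - (w - (z + q)).
      by rewrite opprB addrA subrK.
    by rewrite [leRHS]dot_sqrB o mulr0 subr0 lerDl dot_ge0.
  left; exists (z + q); split => //; first exact: zqmin.
  by apply/supp_subP => i zi; rewrite !mxE zi (supp_subP _ _ sq i zi) addr0.
rewrite -ltNge mxE => zqi; right.
have neg : exists i, q i 0 < 0.
  by exists i; case: Fz => _ /(_ i); lra.
have [t [t0 Ft st t1]] := ratio_test_Fp Fz Mq sq neg.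
exists (z + t *: q); split => //.
have {}t1 := t1 i zqi; have o := orth q Nq.
have -> : x - (z + t *: q) = (x - z - q) + (1 - t) *: q.
  by rewrite scalerBl scale1r opprD !addrA subrK.
have -> : dot (x - z) (x - z) = dot (x - z - q) (x - z - q) + dot q q.
  by rewrite -[in LHS](subrK q (x - z)) [LHS]dot_sqrD o mulr0 addr0.
rewrite [leLHS]dot_sqrD !(dotZl, dotZr) o.
rewrite !mulr0 addr0 lerD2l mulrA ler_piMl ?dot_ge0 //; nra.
Qed.

End StandardForm.

(** * Sharpness and perturbations of the objective *)

Section Sharpness.
Context {R : realType} {m n : nat}.
Variables (A : 'M[R]_(m, n)) (b : 'cV[R]_m) (c : 'cV[R]_n).
Implicit Types (x z d p w g : 'cV[R]_n).

Lemma Xstar_level xs : Xstar A b c xs ->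
  forall x, Xstar A b c x <-> Fp A b x /\ dot c x = dot c xs.
Proof.
move=> [Fxs xsmin] x; split => [[Fx xmin]|[Fx cx]].
  by split => //; apply/eqP; rewrite eq_le xmin //= xsmin.
by split => // z Fz; rewrite cx xsmin.
Qed.

Lemma nearest_Xstar x : Xstar A b c !=set0 ->
  exists2 p, Xstar A b c p &
    forall w, Xstar A b c w -> euclid_norm (x - p) <= euclid_norm (x - w).
Proof.
move=> [xs Xxs]; have lev := Xstar_level Xxs.
have XF w : Xstar A b c w <->
    Fp (col_mx A c^T) (col_mx b (dot c xs)%:M) w.
  by rewrite lev Fp_level.
have [|p /XF Xp pmin] :=
    @nearest_attained _ _ _ (col_mx A c^T) (col_mx b (dot c xs)%:M) x.
  by exists xs; apply/XF.
by exists p => // w /XF; exact: pmin.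
Qed.

Lemma Xstar_obtuse x p w : Xstar A b c p ->
  (forall w, Xstar A b c w -> euclid_norm (x - p) <= euclid_norm (x - w)) ->
  Xstar A b c w -> dot (x - p) (w - p) <= 0.
Proof.
move=> Xp pmin Xw; apply: (nearest_obtuse pmin) => t t01.
have lev := Xstar_level Xp; have [Fw cw] := (lev w).1 Xw.
apply/lev; split; first by apply: Fp_segment => //; case: Xp.
by rewrite !dot_linE cw; ring.
Qed.

Lemma Xstar_rec_ge0 d : Xstar A b c !=set0 -> A *m d = 0 ->
  nonneg_orthant d -> 0 <= dot c d.
Proof.
move=> [xs [Fxs xsmin]] Ad d0.
by have := xsmin _ (Fp_ray Fxs Ad d0); rewrite dotDr lerDl.
Qed.

(** Inside the affine space [A x = b] the level set of the optimal value is a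
    hyperplane with normal the projected cost vector, so the nearest point is
    reached along that normal. *)
Lemma euclid_dist_level x xs : Xstar A b c xs -> Fp A b x ->
  0 < euclid_norm (euclid_proj (null_space A) c) ->
  euclid_dist x (Vp A b `&` Hpstar A b c) =
    (dot c x - dot c xs) / euclid_norm (euclid_proj (null_space A) c).
Proof.
move=> Xxs Fx; set q := euclid_proj _ c => q0.
have Aq : A *m q = 0 by have [] := euclid_proj_nullP A c.
have cq z : A *m z = 0 -> dot c z = dot q z.
  by move=> Az; rewrite dot_euclid_proj_null.
have HE z : Hpstar A b c z <-> dot c z = dot c xs.
  split => [[w Xw ->]|cz]; last by exists xs.
  by have [] := (Xstar_level Xxs w).1 Xw.
set e := dot c x - dot c xs.
have e0 : 0 <= e by rewrite subr_ge0; case: Xxs => _; exact.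
have qq : dot q q != 0 by rewrite -sqr_euclid_norm expf_neq0 ?gt_eqF.
pose p := x - (e / dot q q) *: q.
have xp : euclid_norm (x - p) = e / euclid_norm q.
  rewrite opprB addrC subrK euclid_normZ ger0_norm ?divr_ge0 ?dot_ge0 //.
  by rewrite -sqr_euclid_norm; field; rewrite gt_eqF.
rewrite -xp; apply: euclid_distE.
  case: Fx => Ax _; split.
    by rewrite /Vp /= mulmxBr -scalemxAr Aq scaler0 subr0.
  apply/HE; rewrite !dot_linE (cq q Aq) /e; field.
  exact: qq.
move=> z [Az /HE cz]; rewrite xp ler_pdivrMr // mulrC.
have Axz : A *m (x - z) = 0 by case: Fx => Ax _; rewrite mulmxBr Ax Az subrr.
by rewrite /e -cz -dotNr -dotDr (cq _ Axz) cauchy_schwarz.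
Qed.

Lemma perturbation_cost x p dc : Xstar A b c p ->
  OPT (c + dc) (Fp A b) x ->
  dot c (x - p) <=
    euclid_norm (euclid_proj (null_space A) dc) * euclid_norm (x - p).
Proof.
move=> [Fp_ _] [Fx xmin].
have Apx : A *m (p - x) = 0.
  by case: Fp_ Fx => Ap _ [Ax _]; rewrite mulmxBr Ap Ax subrr.
have := xmin _ Fp_.
have := cauchy_schwarz (euclid_proj (null_space A) dc) (p - x).
have -> : euclid_norm (p - x) = euclid_norm (x - p).
  by rewrite -opprB -scaleN1r euclid_normZ normrN1 mul1r.
by rewrite dot_euclid_proj_null // !dot_linE; lra.
Qed.

(** The critical scale is [s = min {c . d}] over the recession directions [d]
    with [dc . d = -1], a linear program that is bounded by [0] because [c] is
    nonnegative on the recession cone.  Its minimizer shows that [c + s dc] is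
    at the edge of boundedness, and rescaling an arbitrary recession direction
    into this program shows that it is not beyond it. *)
Lemma critical_scaling dc : Xstar A b c !=set0 ->
  (exists d, [/\ A *m d = 0, nonneg_orthant d & dot (c + dc) d < 0]) ->
  exists s d, [/\ 0 <= s <= 1,
    [/\ A *m d = 0, nonneg_orthant d, dot dc d = -1 & dot c d = s] &
    forall w, A *m w = 0 -> nonneg_orthant w -> 0 <= dot (c + s *: dc) w].
Proof.
move=> X0 [d1 [Ad1 d10 neg]].
have cpos w := Xstar_rec_ge0 (d := w) X0.
have dc1 : dot dc d1 < 0.
  by have := cpos _ Ad1 d10; move: neg; rewrite dotDl; lra.
pose K := Fp (col_mx A dc^T) (col_mx 0 (-1)%:M).
have KP w : K w <-> [/\ A *m w = 0, nonneg_orthant w & dot dc w = -1].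
  by rewrite /K; split => [/Fp_level [[]]|[? ? ?]] //; apply/Fp_level.
have scaleK w : A *m w = 0 -> nonneg_orthant w -> dot dc w < 0 ->
    K ((- dot dc w)^-1 *: w).
  move=> Aw w0 dw; apply/KP; split.
  - by rewrite -scalemxAr Aw scaler0.
  - by move=> i; rewrite mxE mulr_ge0 // invr_ge0 oppr_ge0 ltW.
  - by rewrite dotZr invrN mulNr mulVf ?lt_eqF.
have [||d [/KP[Ad d0 dcd] dmin]] := @lp_attained _ _ _
    (col_mx A dc^T) (col_mx 0 (-1)%:M) c.
- by exists ((- dot dc d1)^-1 *: d1); apply: scaleK.
- move=> w; rewrite mul_col_mx -[in X in _ = X -> _]col_mx0.
  by move=> /eq_col_mx[Aw _]; exact: cpos.
have le_s w : A *m w = 0 -> nonneg_orthant w -> dot dc w < 0 ->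
    dot c d * - dot dc w <= dot c w.
  move=> Aw w0 dw; have := dmin _ (scaleK w Aw w0 dw).
  by rewrite dotZr mulrC ler_pdivlMr ?oppr_gt0.
have s0 := cpos _ Ad d0.
exists (dot c d), d; split => //.
  rewrite s0 /=; have := le_s _ Ad1 d10 dc1; move: neg; rewrite dotDl; nra.
move=> w Aw w0; rewrite dotDl dotZl.
have [dw|dw] := ltP (dot dc w) 0; first by have := le_s w Aw w0 dw; lra.
by rewrite addr_ge0 ?mulr_ge0 // cpos.
Qed.

(** The perturbation is [- s (c . u / |u|^2) u] with [u = x - p], [0 <= s <= 1];
    at [s = 1] the points [x] and [p] have the same perturbed value.  The value
    [s = 1] serves when the perturbed program is bounded, and the critical scale
    otherwise. *)
Lemma efficient_perturbation x p : Fp A b x -> ~ Xstar A b c x ->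
  Xstar A b c p ->
  (forall w, Xstar A b c w -> euclid_norm (x - p) <= euclid_norm (x - w)) ->
  exists dc, [/\ OPT (c + dc) (Fp A b) !=set0,
    ~ (OPT (c + dc) (Fp A b) `<=` OPT c (Fp A b)) &
    euclid_norm (euclid_proj (null_space A) dc) <=
      dot c (x - p) / euclid_norm (x - p)].
Proof.
move=> Fx nXx Xp pmin; set u := x - p.
have lev := Xstar_level Xp; have FXp := Xp.1.
have X0 : Xstar A b c !=set0 by exists p.
have obt w := @Xstar_obtuse x p w Xp pmin.
have u0 : 0 < dot u u.
  rewrite dot_gt0 subr_eq0; apply/eqP => xp; apply: nXx; rewrite xp //.
have Au : A *m u = 0.
  by case: Fx FXp => Ax _ [Ap _]; rewrite mulmxBr Ax Ap subrr.
have cu : 0 < dot c u.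
  rewrite lt0r dotDr dotNr subr_ge0 (Xp.2 x Fx) andbT subr_eq0.
  by apply/eqP => cx; apply: nXx; apply/lev.
pose a := dot c u / dot u u; have a0 : 0 < a by rewrite divr_gt0.
pose dc := - a *: u.
have dcu : dot dc u = - dot c u by rewrite dotZl /a; field; rewrite gt_eqF.
have norm_le s : 0 <= s <= 1 ->
    euclid_norm (euclid_proj (null_space A) (s *: dc)) <=
      dot c u / euclid_norm u.
  move=> /andP[s0 s1]; have nu : 0 < euclid_norm u by rewrite sqrtr_gt0.
  rewrite euclid_proj_null_fix; last by rewrite -!scalemxAr Au !scaler0.
  rewrite !euclid_normZ normrN (ger0_norm s0) (gtr0_norm a0) /a -sqr_euclid_norm.
  have -> : dot c u / euclid_norm u ^+ 2 * euclid_norm u =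
    dot c u / euclid_norm u by field; rewrite gt_eqF.
  by rewrite ler_piMl // divr_ge0 ?ltW.
have [unbdd|bdd] := pselect
    (exists d, [/\ A *m d = 0, nonneg_orthant d & dot (c + dc) d < 0]).
  have [s [d [s01 [Ad d0 dcd cd] rec]]] := critical_scaling X0 unbdd.
  exists (s *: dc); split; last exact: norm_le.
    by apply: lp_attained => //; exists x.
  have [|w [Fw wmin]] := @lp_attained _ _ _ A b (c + s *: dc) _ rec.
    by exists x.
  (* [d] is a direction of constant perturbed value, so [w + d] is optimal for
     the perturbed objective, hence in [Xstar]: this forces [c . d = 0]. *)
  move=> sub; have Fwd := Fp_ray Fw Ad d0.
  have Xw : Xstar A b c w by exact: sub.
  have Xwd : Xstar A b c (w + d).
    apply: sub; split => // z Fz; apply: le_trans (wmin z Fz).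
    by rewrite dotDr (dotDl _ _ d) dotZl cd dcd; lra.
  have cd0 : dot c d = 0.
    by have [_] := (lev _).1 Xwd; have [_ <-] := (lev _).1 Xw; rewrite dotDr; lra.
  have /obt : Xstar A b c (p + d).
    by apply/lev; rewrite dotDr cd0 addr0; split => //; apply: Fp_ray.
  rewrite addrAC subrr add0r -/u => ud; move: dcd; rewrite dotZl; nra.
have rec d : A *m d = 0 -> nonneg_orthant d -> 0 <= dot (c + dc) d.
  by move=> Ad d0; rewrite leNgt; apply/negP => neg; apply: bdd; exists d.
have opt : OPT (c + dc) (Fp A b) !=set0.
  by apply: lp_attained => //; exists x.
exists dc; split => //; last by rewrite -[dc]scale1r norm_le // ler01 lexx.
(* A perturbed optimum [w] in [Xstar] has [dc . w >= dc . p] by the obtuse angle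
   at [p], hence is no better than [p], which has the perturbed value of [x]. *)
move=> sub; apply: nXx; apply: (sub); split => // z Fz.
have [w wopt] := opt; have Xw := sub _ wopt; have := wopt.2 z Fz.
apply: le_trans; have := obt w Xw; rewrite -/u => uw.
have [_ cw] := (lev w).1 Xw.
have -> : dot (c + dc) x = dot (c + dc) p.
  by apply/eqP; rewrite -subr_eq0 -dotNr -dotDr dotDl dcu subrr.
rewrite !dotDl cw lerD2l !dotZl -subr_ge0 -mulrBr -dotNr -dotDr; nra.
Qed.

End Sharpness.

(** * Sharpness as a distance to changed optimal sets *)

Theorem theorem5p1 (R : realType) (m n : nat)
    (A : 'M[R]_(m, n)) (b : 'cV[R]_m) (c : 'cV[R]_n)
    (hLP : lp_assumption A b c) :
  lp_sharpness A b c =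
  ereal_inf [set (euclid_norm (euclid_proj (null_space A) dc)
                  / euclid_norm (euclid_proj (null_space A) c))%:E
            | dc in [set dc : 'cV[R]_n |
                OPT (c + dc) (Fp A b) !=set0 /\
                ~ (OPT (c + dc) (Fp A b) `<=` OPT c (Fp A b))]].
Proof.
case: hLP => X0 [x0 [Fx0 nXx0]] _.
(* If [c] were orthogonal to the null space, all feasible points would have the
   same objective value, and [x0] would be optimal. *)
have q0 : 0 < euclid_norm (euclid_proj (null_space A) c).
  rewrite euclid_norm_gt0; apply/eqP => q0.
  have [xs Xxs] := X0; apply: nXx0; apply/(Xstar_level Xxs); split => //.
  have Axx : A *m (x0 - xs) = 0.
    by case: Fx0 Xxs.1 => Ax _ [Axs _]; rewrite mulmxBr Ax Axs subrr.
  have := dot_euclid_proj_null c Axx; rewrite q0 dot0l dotDr dotNr; lra.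
have ratioE x p : Fp A b x -> Xstar A b c p ->
    (forall w, Xstar A b c w -> euclid_norm (x - p) <= euclid_norm (x - w)) ->
    euclid_dist x (Vp A b `&` Hpstar A b c) / euclid_dist x (Xstar A b c) =
    dot c (x - p) / euclid_norm (x - p)
      / euclid_norm (euclid_proj (null_space A) c).
  move=> Fx Xp pmin; rewrite (euclid_distE Xp pmin).
  by rewrite (euclid_dist_level Xp Fx q0) dotDr dotNr mulrAC.
have xp0 x p : ~ Xstar A b c x -> Xstar A b c p -> 0 < euclid_norm (x - p).
  move=> nX Xp; rewrite euclid_norm_gt0 subr_eq0.
  by apply/eqP => xp; apply: nX; rewrite xp.
apply/eqP; rewrite eq_le; apply/andP; split; apply: le_ereal_inf_tmp.
  move=> _ [dc [[_ _] /existsNP[x /not_implyP[xopt nXx]]] <-].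
  have [p Xp pmin] := nearest_Xstar x X0.
  apply: ge_ereal_inf.
  exists (euclid_dist x (Vp A b `&` Hpstar A b c)
          / euclid_dist x (Xstar A b c))%:E.
    by exists x => //; split => //; exact: xopt.1.
  rewrite lee_fin (ratioE x p xopt.1 Xp pmin) ler_pM2r ?invr_gt0 //.
  by rewrite ler_pdivrMr ?xp0 // (perturbation_cost Xp xopt).
move=> _ [x [Fx nXx] <-].
have [p Xp pmin] := nearest_Xstar x X0.
have [dc [opt nsub le_dc]] := efficient_perturbation Fx nXx Xp pmin.
apply: ge_ereal_inf.
exists (euclid_norm (euclid_proj (null_space A) dc)
        / euclid_norm (euclid_proj (null_space A) c))%:E.
  by exists dc.
by rewrite lee_fin (ratioE x p Fx Xp pmin) ler_pM2r ?invr_gt0.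
Qed.
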